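(* Let $X,Y,Z$ be indeterminates and let $(f_s)_{s\in\mathbb{P}^1\mathbb{Q}}$ be the family of rational functions in $X,Y,Z$ defined by $f_0=X$, $f_\infty=Y$, $f_{-1}=Z$ and $$f_s+f_{s'}=f_{s_0}f_{s_1}\,\frac{X^2+Y^2+Z^2}{XYZ}$$ whenever $s_0s_1s$ and $s_0s_1s'$ are two distinct Farey triangles sharing the edge $s_0s_1$. Then for every $s\in\mathbb{P}^1\mathbb{Q}$, $f_s$ is a Laurent polynomial in $X,Y,Z$ with integer coefficients, all of whose nonzero coefficients are positive integers. Moreover, every monomial $X^aY^bZ^c$ such that $(a,b,c)$ lies in the Newton polygon of $f_s$ and such that $a,b,c$ are congruent modulo $2$ to the exponents of $X,Y,Z$ respectively in the monomial $f_{[s]}\in\{X,Y,Z\}$ appears in $f_s$ with a nonzero coefficient.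
   Context: $\mathbb{P}^1\mathbb{Q}=\mathbb{Q}\cup\{\infty\}$, with $\infty=\frac{\pm1}{0}$. A Farey triangle is a triple of points of $\mathbb{P}^1\mathbb{Q}$ of the form $\left(\frac{q_0}{p_0},\frac{q_0+q_1}{p_0+p_1},\frac{q_1}{p_1}\right)$ with $p_i,q_i\in\mathbb{Z}$ and $q_0p_1-q_1p_0=\pm1$; equivalently, the ideal triangles of the Farey triangulation of the hyperbolic plane, obtained from the ideal triangle with vertices $1,\infty,0$ by repeated reflection in its sides. Every Farey edge $s_0s_1$ belongs to exactly two Farey triangles. Since the dual graph of the Farey triangulation is a tree and the defining relation is symmetric in $s,s'$, the family $(f_s)$ exists and is uniquely determined by the stated conditions (starting from the Farey triangle $0,\infty,-1$). For $s\in\mathbb{P}^1\mathbb{Q}$, $[s]$ denotes the unique element of $\{0,-1,\infty\}$ having the same image as $s$ in $\mathbb{P}^1(\mathbb{Z}/2\mathbb{Z})$, so $f_{[s]}$ is one of $X,Y,Z$. The Newton polygon of a Laurent polynomial $\sum a_{\nu}X^{\nu_1}Y^{\nu_2}Z^{\nu_3}$ is the convex hull in $\mathbb{R}^3$ of the exponent vectors $\nu\in\mathbb{Z}^3$ with $a_\nu\neq0$. *)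

(* Defs.v *)
From HB Require Import structures.
From mathcomp Require Import all_boot all_order all_algebra.
From mathcomp Require Import reals.
Set Implicit Arguments. Unset Strict Implicit. Unset Printing Implicit Defensive.
Import Order.TTheory GRing.Theory Num.Theory.
Local Open Scope ring_scope.

Definition ZXYZ := {poly {poly {poly int}}}.
Definition RatFun := {fraction ZXYZ}.

Definition Xv : RatFun := FracField.tofrac ('X%:P%:P : ZXYZ).
Definition Yv : RatFun := FracField.tofrac ('X%:P : ZXYZ).
Definition Zv : RatFun := FracField.tofrac ('X : ZXYZ).

Definition exps := (int * int * int)%type.

Definition mono (e : exps) : RatFun := Xv ^ e.1.1 * Yv ^ e.1.2 * Zv ^ e.2.

Definition laurent (c : exps -> int) (S : seq exps) : RatFun :=
  \sum_(nu <- S) (c nu)%:~R * mono nu.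

Definition P1Q := option rat.
Definition oo : P1Q := None.

Definition pt (q p : int) : P1Q :=
  if p == 0 then None else Some (q%:~R / p%:~R).

Definition farey_tri (a b c : P1Q) : Prop :=
  exists q0 p0 q1 p1 : int,
    (q0 * p1 - q1 * p0 = 1 \/ q0 * p1 - q1 * p0 = -1) /\
    perm_eq [:: a; b; c] [:: pt q0 p0; pt (q0 + q1) (p0 + p1); pt q1 p1].

(* [s]: the element of {0, -1, oo} with the same image in P^1(Z/2Z).
   For s = q/p in lowest terms, the image is (q mod 2 : p mod 2). *)
Definition bracket (s : P1Q) : P1Q :=
  match s with
  | None => None
  | Some r =>
      if ~~ odd `|denq r|%N then None
      else if ~~ odd `|numq r|%N then Some 0
      else Some (-1)
  end.

Definition in_hull (R : realType) (S : seq exps) (nu : exps) : Prop :=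
  exists lam : exps -> R,
    (forall mu, 0 <= lam mu) /\
    \sum_(mu <- S) lam mu = 1 /\
    \sum_(mu <- S) lam mu * (mu.1.1)%:~R = (nu.1.1)%:~R /\
    \sum_(mu <- S) lam mu * (mu.1.2)%:~R = (nu.1.2)%:~R /\
    \sum_(mu <- S) lam mu * (mu.2)%:~R = (nu.2)%:~R.

Definition same_parity (nu e : exps) : Prop :=
  [/\ (nu.1.1 - e.1.1 \in dvdz 2)%Z, (nu.1.2 - e.1.2 \in dvdz 2)%Z
    & (nu.2 - e.2 \in dvdz 2)%Z].

(* Main.v *)
Require Import Defs.
From HB Require Import structures.
From mathcomp Require Import all_boot all_order all_algebra.
From mathcomp Require Import reals.
From mathcomp Require Import zify ring.
Set Implicit Arguments. Unset Strict Implicit. Unset Printing Implicit Defensive.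
Import Order.TTheory GRing.Theory Num.Theory.
Local Open Scope ring_scope.

(** Up to rotating (X, Y, Z) one may take s = q/p with p, q >= 0. There f_s is
    YZ/X times the upper right entry of a product of two matrices A, B of
    determinant 1 with positive Laurent entries, taken along the Christoffel
    word of s (q letters B and p letters A): on the Stern-Brocot tree these
    words concatenate, and the Farey recurrence becomes M^2 = tr(M) M - 1 since
    tr M is (X^2+Y^2+Z^2)/(XYZ) times f_s. So nothing ever cancels, and the
    supports of the entries evolve by unions and translations only. Along a
    Christoffel word they stay sets of all lattice points of a polygon; in the
    end the support of f_s consists of the
    X^(2a+1-q) Y^(2b+1-p) Z^(p+q-1-2a-2b) with a, b >= 0, a + b < p + q and
    pa + qb >= pq, which is cut out by half-spaces and a parity condition. *)

(** * Christoffel words and the supports they generate *)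

(* The letter [true] is a step of p, [false] a step of q; a word obeys (q, p) if
   each next letter increments the smaller of q k and p (j + 1), where k and j
   count the letters [true] and [false] so far. *)
Definition obeys (q p : nat) (w : seq bool) : Prop :=
  forall u l v, w = u ++ l :: v ->
    l = (q * count id u < p * (count negb u).+1)%N.

Definition christoffel (q p : nat) (w : seq bool) : Prop :=
  [/\ count negb w = q, count id w = p & obeys q p w].

Lemma obeys_catl q p u v : obeys q p (u ++ v) -> obeys q p u.
Proof. by move=> H u' l v' e; apply: (H u' l (v' ++ v)); rewrite e -catA. Qed.

Lemma split_cat (T : Type) (w w' u v : seq T) (l : T) :
  w ++ w' = u ++ l :: v ->
  (exists v', w = u ++ l :: v') \/ (exists u', u = w ++ u' /\ w' = u' ++ l :: v).
Proof.
elim: w u => [|x w IH] [|y u] /=.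
- by right; exists [::].
- by right; exists (y :: u).
- by case=> -> _; left; exists w.
case=> -> /IH [[v' ->]|[u' [-> ->]]]; first by left; exists v'.
by right; exists u'.
Qed.

(** Let D = p (j + 1) - q k, whose positivity decides the letter, and let D' be its analogue for the
    summed pair at the same place. The determinant condition gives p D' = (p + p') D - k inside [w],
    and q' D' = (q + q') D + (j + 1) - q' inside [w'], with D, j, k taken there for (q', p'). As k <
    p at a letter [true] of [w] and j < q' at a letter [false] of [w'], the corrections never change
    whether D > 0. *)
Lemma christoffel_cat q p q' p' w w' :
  (p * q' = q * p' + 1)%N -> christoffel q p w -> christoffel q' p' w' ->
  christoffel (q + q') (p + p') (w ++ w').
Proof.
move=> det [cq cp ob] [cq' cp' ob'].
split; [by rewrite count_cat cq cq'|by rewrite count_cat cp cp'|].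
move=> u l v euv; case: (split_cat euv) => [[v' ew]|[u' [-> ew']]].
- have := ob _ _ _ ew; have := cp; rewrite ew count_cat /=.
  set k := count id u; set j := count negb u; set d := count id v' => kp e.
  rewrite e.
  have E : (p * ((p + p') * j.+1) + k + (p + p') * (q * k)
            = p * ((q + q') * k) + (p + p') * (p * j.+1))%N by nia.
  have p0 : (0 < p)%N by nia.
  apply/idP/idP => H; rewrite ?H in e; subst l.
  + rewrite ltnNge; apply/negP => G; rewrite add1n in kp.
    have : (p * ((p + p') * j.+1) <= p * ((q + q') * k))%N by rewrite leq_mul2l G orbT.
    have : ((p + p') * (q * k).+1 <= (p + p') * (p * j.+1))%N by rewrite leq_mul2l H orbT.
    rewrite [X in (X <= _)%N]mulnS; lia.
  + rewrite ltnNge; apply/negP => G; move: H; rewrite ltnNge => /negP; apply.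
    rewrite -(leq_pmul2l p0).
    have : ((p + p') * (p * j.+1) <= (p + p') * (q * k))%N by rewrite leq_mul2l G orbT.
    lia.
- have := ob' _ _ _ ew'; have := cq'; rewrite ew' !count_cat /= cq cp.
  set k := count id u'; set j := count negb u'; set d := count negb v => jq e.
  rewrite e.
  have E : (q' * ((p + p') * (q + j).+1) + (q + q') * (q' * k) + q'
            = q' * ((q + q') * (p + k)) + (q + q') * (p' * j.+1) + j.+1)%N by nia.
  have q0 : (0 < q')%N by nia.
  apply/idP/idP => H; rewrite ?H in e; subst l.
  + rewrite ltnNge; apply/negP => G.
    have : (q' * ((p + p') * (q + j).+1) <= q' * ((q + q') * (p + k)))%N.
      by rewrite leq_mul2l G orbT.
    have : ((q + q') * (q' * k).+1 <= (q + q') * (p' * j.+1))%N by rewrite leq_mul2l H orbT.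
    rewrite [X in (X <= _)%N]mulnS; lia.
  + rewrite ltnNge; apply/negP => G; move: H; rewrite ltnNge => /negP; apply.
    rewrite -(leq_pmul2l q0).
    have : ((q + q') * (p' * j.+1) <= (q + q') * (q' * k))%N by rewrite leq_mul2l G orbT.
    have : ~~ (q' * k < p' * j.+1)%N by rewrite -leqNgt.
    move/negbTE => F; rewrite F /= in jq.
    lia.
Qed.

Definition raise (e : nat * nat) := (e.1, e.2.+1).
Definition widen (e : nat * nat) := (e.1.+1, e.2).

(* A pair (a, b) stands for the monomial [monom X Y Z j k (a, b)] below; the two
   lists are the supports, with multiplicity, of the two entries of the first
   row of a word matrix. *)
Definition step (L : seq (nat * nat) * seq (nat * nat)) (l : bool) :=
  if l then (map raise (L.1 ++ L.2), map widen (L.1 ++ L.2) ++ L.2)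
  else (map raise (L.1 ++ L.2) ++ L.1, map widen (L.1 ++ L.2)).

Definition row_support (w : seq bool) := foldl step ([:: (0, 0)], [::])%N w.

Lemma mem_raise a b s : ((a, b) \in map raise s) = (0 < b)%N && ((a, b.-1) \in s).
Proof.
apply/mapP/andP => [[[a' b'] /= i [-> ->]] //|[b0 i]].
by exists (a, b.-1) => //; rewrite /raise /= prednK.
Qed.

Lemma mem_widen a b s : ((a, b) \in map widen s) = (0 < a)%N && ((a.-1, b) \in s).
Proof.
apply/mapP/andP => [[[a' b'] /= i [-> ->]] //|[b0 i]].
by exists (a.-1, b) => //; rewrite /widen /= prednK.
Qed.

(* The bound [count negb w < q] keeps ties q k = p (j + 1) out of the way: they
   only occur at the last letter of a Christoffel word. *)
Lemma mem_row_support (q p : nat) (w : seq bool) :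
  coprime q p -> (0 < p)%N -> (count negb w < q)%N -> (0 < size w)%N ->
  obeys q p w ->
  let j := count negb w in let k := count id w in
  [/\ (forall a b, ((a, b) \in (row_support w).1) =
         [&& 0 < b, a + b <= j + k & q * k <= p * a + q * b])%N,
      (forall a b, ((a, b) \in (row_support w).2) =
         [&& 0 < a, a + b <= j + k & p * j.+1 <= p * a + q * b])%N,
      (0 < k)%N, (q * k.-1 < p * j.+1)%N & (p * j < q * k)%N].
Proof.
move=> cqp p0; elim/last_ind: w => // w l IH.
case: (posnP (size w)) => [/size0nil ->|w0] jq _ ob.
  have -> : l = true by rewrite (ob [::] l [::]) //= muln0 muln1.
  rewrite /= /row_support /=; split=> //=.
  - by case=> [|a] [|b] //; rewrite mem_seq1 xpair_eqE /=; nia.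
  - by case=> [|a] [|b] //; rewrite mem_seq1 xpair_eqE /=; nia.
  - lia.
  - move: jq; lia.
have obl := ob w l [::] (esym (cats1 w l)).
move: ob jq; rewrite -cats1 => /obeys_catl ob.
rewrite /row_support !count_cat /= foldl_cat -/(row_support w) /=.
move=> jq.
case: IH => //; first lia.
set j := count negb w in obl jq *; set k := count id w in obl jq *.
case: (row_support w) => r1 r2 /= H1 H2 k0 c1 c2.
have qk : (q * k = q * k.-1 + q)%N by rewrite -[in LHS](prednK k0) mulnS addnC.
(* Monotonicity of multiplication, as a case split that leaves only linear arithmetic. *)
have mul m a b : (a <= b /\ m * a <= m * b \/ b < a /\ m * b.+1 <= m * a)%N.
  by case: (leqP a b) => ab; [left|right]; rewrite leq_mul2l ab orbT.
have [mulp mulq] := (mul p, mul q).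
rewrite /step; case: l obl jq => obl jq /=; rewrite ?addn0 ?add0n ?addn1 in jq *.
(* Here p j < q k < p (j + 1). For b > 0 the first support contains the second; for b = 0 the bounds
   q k and p (j + 1) on p a agree. So the union is cut out by q k <= p a + q b without gaps. *)
- split=> //.
  + move=> a [|b]; rewrite mem_raise mem_cat H1 H2 //= ?mulnS.
    have := mulp a j; case: a => [|a]; case: b => [|b]; rewrite ?muln0 ?mulnS; lia.
  + move=> [|a] b; rewrite mem_cat mem_widen mem_cat !H1 !H2 //= ?mulnS.
    have := mulp j.+1 a; have := mulq k b; rewrite ?mulnS in c1 c2 obl *.
    case: a => [|a]; case: b => [|b]; rewrite ?muln0 ?mulnS; lia.
  + rewrite ?mulnS in c2 *; lia.
(* A tie would make q divide j + 1, which is below q. Now q (k - 1) < p (j + 1) < q k, and the union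
   is filled as before, with the axis a = 0 in place of b = 0. *)
- have lt : (p * j.+1 < q * k)%N.
    rewrite ltn_neqAle; apply/andP; split; last lia.
    apply/eqP => E; have : (q %| p * j.+1)%N by rewrite E dvdn_mulr.
    rewrite Gauss_dvdr // => /dvdn_leq; lia.
  split=> //.
  + move=> a [|b]; rewrite mem_cat mem_raise mem_cat !H1 H2 //=.
    have := mulp j.+1 a; have := mulq k b; rewrite ?mulnS in c1 c2 lt *.
    case: a => [|a]; case: b => [|b]; rewrite ?muln0 ?mulnS; lia.
  + move=> [|a] b; rewrite mem_widen mem_cat H1 H2 //= ?mulnS.
    have := mulq k b; case: a => [|a]; case: b => [|b]; rewrite ?muln0 ?mulnS; lia.
  + rewrite ?mulnS in c1 *; lia.
Qed.

(** * Matrices attached to words *)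

Lemma ord2E (i : 'I_2) : i = 0 \/ i = 1.
Proof. by case: i => [[|[|//]] ?]; [left|right]; apply/val_inj. Qed.

Lemma mulmx2E (R : pzSemiRingType) (A B : 'M[R]_2) i j :
  (A *m B) i j = A i 0 * B 0 j + A i 1 * B 1 j.
Proof. by rewrite mxE 2!big_ord_recl big_ord0 addr0; congr (_ + A i _ * B _ j); apply/val_inj. Qed.

Lemma mxtrace2 (R : pzSemiRingType) (A : 'M[R]_2) : \tr A = A 0 0 + A 1 1.
Proof. by rewrite /mxtrace 2!big_ord_recl big_ord0 addr0; congr (_ + A _ _); apply/val_inj. Qed.

Lemma det2 (R : comNzRingType) (A : 'M[R]_2) :
  \det A = A 0 0 * A 1 1 - A 0 1 * A 1 0.
Proof.
rewrite (expand_det_row _ 0) 2!big_ord_recl big_ord0 addr0 /cofactor !det_mx11 !mxE /=.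
have -> : lift 0 0 = 1 :> 'I_2 by apply/val_inj.
have -> : lift 1 0 = 0 :> 'I_2 by apply/val_inj.
by rewrite /= expr0 expr1 mul1r mulN1r mulrN.
Qed.

Lemma sqrmx_SL2 (R : comNzRingType) (A : 'M[R]_2) :
  \det A = 1 -> A *m A = \tr A *: A - 1%:M.
Proof.
rewrite det2 => dA; apply/matrixP => i j; rewrite mulmx2E mxtrace2 !mxE.
by case: (ord2E i) => ->; case: (ord2E j) => -> /=; rewrite ?mulr1n ?mulr0n -?dA; ring.
Qed.

(** [true] gives the matrix A and [false] the matrix B. Right multiplication by A sends a row (r, s)
    to ((r + s) Y/Z, (r + s) X^2/(YZ) + s Z/Y), and B acts likewise; [step] records this on
    supports. *)
Definition letter_mx (F : fieldType) (X Y Z : F) (l : bool) : 'M[F]_2 :=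
  \matrix_(i, j)
    if l then (if j == 0 then Y / Z else X ^+ 2 / (Y * Z) + (if i == 0 then 0 else Z / Y))
    else (if j == 0 then Y ^+ 2 / (X * Z) + (if i == 0 then Z / X else 0) else X / Z).

Definition word_mx (F : fieldType) (X Y Z : F) (w : seq bool) : 'M[F]_2 :=
  \prod_(l <- w) letter_mx X Y Z l.

Lemma word_mx_cat (F : fieldType) (X Y Z : F) w w' :
  word_mx X Y Z (w ++ w') = word_mx X Y Z w *m word_mx X Y Z w'.
Proof. by rewrite /word_mx big_cat. Qed.

Lemma det_word_mx (F : fieldType) (X Y Z : F) w :
  X != 0 -> Y != 0 -> Z != 0 -> \det (word_mx X Y Z w) = 1.
Proof.
move=> X0 Y0 Z0; elim: w => [|l w IH]; rewrite /word_mx ?big_nil ?big_cons ?det1 // det_mulmx.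
rewrite IH mulr1 det2 !mxE /=; by case: l; field; rewrite ?X0 ?Y0 ?Z0.
Qed.

(** Total degree 0. With j and k the letter counts, the factors occurring in A and B become unit
    translations of (a, b), or the identity once j or k has grown. *)
Definition monom (F : fieldType) (X Y Z : F) (j k : nat) (e : nat * nat) : F :=
  X ^ (e.1%:Z *+ 2 - j%:Z) * Y ^ (e.2%:Z *+ 2 - k%:Z)
  * Z ^ (j%:Z + k%:Z - e.1%:Z *+ 2 - e.2%:Z *+ 2).

Lemma monom_shift (F : fieldType) (X Y Z : F) (j k j' k' : nat) (e e' : nat * nat) (a b c : int) :
  X != 0 -> Y != 0 -> Z != 0 ->
  e'.1%:Z *+ 2 - j'%:Z = e.1%:Z *+ 2 - j%:Z + a ->
  e'.2%:Z *+ 2 - k'%:Z = e.2%:Z *+ 2 - k%:Z + b ->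
  - a - b = c ->
  monom X Y Z j' k' e' = monom X Y Z j k e * (X ^ a * Y ^ b * Z ^ c).
Proof.
move=> X0 Y0 Z0 ea eb ec.
rewrite /monom ea eb.
have -> : j'%:Z + k'%:Z - e'.1%:Z *+ 2 - e'.2%:Z *+ 2
         = (j%:Z + k%:Z - e.1%:Z *+ 2 - e.2%:Z *+ 2) + c by lia.
rewrite !expfzDr //; ring.
Qed.

Lemma row_word_mx (F : fieldType) (X Y Z : F) (w : seq bool) :
  X != 0 -> Y != 0 -> Z != 0 ->
  let m := monom X Y Z (count negb w) (count id w) in
  word_mx X Y Z w 0 0 = \sum_(e <- (row_support w).1) m e /\
  word_mx X Y Z w 0 1 = \sum_(e <- (row_support w).2) m e.
Proof.
move=> X0 Y0 Z0; elim/last_ind: w => [|w l [IH1 IH2]].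
  by rewrite /word_mx /= big_nil big_seq1 big_nil !mxE /monom /= !expr0z !mulr1.
rewrite -cats1 word_mx_cat /= !mulmx2E /row_support foldl_cat
  -/(row_support w) /= IH1 IH2 /word_mx big_seq1 !mxE /= !count_cat /= !addn0.
case: (row_support w) => r1 r2 /=.
have shift s g c j k a b : (forall e, (g e).1%:Z *+ 2 - j%:Z = e.1%:Z *+ 2 - (count negb w)%:Z + a) ->
    (forall e, (g e).2%:Z *+ 2 - k%:Z = e.2%:Z *+ 2 - (count id w)%:Z + b) ->
    c = X ^ a * Y ^ b * Z ^ (- a - b) ->
    \sum_(e <- map g s) monom X Y Z j k e
      = (\sum_(e <- s) monom X Y Z (count negb w) (count id w) e) * c.
  move=> ga gb ->; rewrite big_map mulr_suml; apply: eq_bigr => e _.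
  exact: monom_shift.
(* The factors Z/Y and Z/X leave (a, b) alone: the new letter count alone accounts for them. *)
have shift0 s c j k a b : - j%:Z = - (count negb w)%:Z + a ->
    - k%:Z = - (count id w)%:Z + b ->
    c = X ^ a * Y ^ b * Z ^ (- a - b) ->
    \sum_(e <- s) monom X Y Z j k e
      = (\sum_(e <- s) monom X Y Z (count negb w) (count id w) e) * c.
  by move=> ja kb cE; rewrite -[s in LHS]map_id; apply: (@shift s id c j k a b) => // e /=; lia.
case: l; rewrite /= ?addn0 ?addn1 big_cat /=; split.
- rewrite (@shift _ raise (Y / Z) _ _ 0 1); first by rewrite big_cat /= mulrDl.
  + by move=> e /=; lia.
  + by move=> e /=; lia.
  + by rewrite /exprz /= expr0 !expr1 mul1r.
- rewrite (@shift _ widen (X ^+ 2 / (Y * Z)) _ _ 2 (-1)).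
    rewrite (@shift0 r2 (Z / Y) _ (count id w).+1 0 (-1)).
    + by rewrite big_cat /= addr0 mulrDr mulrDl addrA.
    + by lia.
    + by lia.
    + by rewrite /exprz /= expr0 !expr1 mul1r mulrC.
  + by move=> e /=; lia.
  + by move=> e /=; lia.
  + by rewrite /exprz /= !expr1 invfM mulrA.
- rewrite (@shift _ raise (Y ^+ 2 / (X * Z)) _ _ (-1) 2).
    rewrite (@shift0 r1 (Z / X) (count negb w).+1 _ (-1) 0).
    + by rewrite big_cat /= addr0 mulrDr mulrDl addrAC.
    + by lia.
    + by lia.
    + by rewrite /exprz /= expr0 !expr1 mulr1 mulrC.
  + by move=> e /=; lia.
  + by move=> e /=; lia.
  + by rewrite /exprz /= !expr1 invfM mulrA [_ * Y ^+ 2]mulrC.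
- rewrite (@shift _ widen (X / Z) _ _ 1 0); first by rewrite big_cat /= mulrDl.
  + by move=> e /=; lia.
  + by move=> e /=; lia.
  + by rewrite /exprz /= expr0 !expr1 mulr1.
Qed.

(** * Descent along the Stern-Brocot tree *)

Inductive stern_brocot : nat -> nat -> nat -> nat -> Prop :=
| SB_root : stern_brocot 0 1 1 0
| SB_left q p q' p' : stern_brocot q p q' p' -> stern_brocot q p (q + q') (p + p')
| SB_right q p q' p' : stern_brocot q p q' p' -> stern_brocot (q + q') (p + p') q' p'.

Lemma stern_brocot_det q p q' p' : stern_brocot q p q' p' -> (p * q' = q * p' + 1)%N.
Proof. by elim=> [|{}q {}p {}q' {}p' _|{}q {}p {}q' {}p' _] //; lia. Qed.

(** The translation s -> s + 1 maps the tree onto the right subtree of its root; dually, the next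
    lemma reaches the left subtree. *)
Lemma stern_brocot_addl q p q' p' :
  stern_brocot q p q' p' -> stern_brocot (q + p) p (q' + p') p'.
Proof.
elim=> [|{}q {}p {}q' {}p' _ /SB_left|{}q {}p {}q' {}p' _ /SB_right]; rewrite 1?addnACA //.
exact: SB_right SB_root.
Qed.

Lemma stern_brocot_addr q p q' p' :
  stern_brocot q p q' p' -> stern_brocot q (p + q) q' (p' + q').
Proof.
elim=> [|{}q {}p {}q' {}p' _ /SB_left|{}q {}p {}q' {}p' _ /SB_right]; rewrite 1?addnACA //.
exact: SB_left SB_root.
Qed.

(** Subtractive Euclidean algorithm: each subtraction is undone by one of the two shears, and q = p
    = 1 is the mediant at the root. *)
Lemma stern_brocot_coprime q p : coprime q p -> (0 < q)%N -> (0 < p)%N ->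
  exists q0 p0 q1 p1, [/\ stern_brocot q0 p0 q1 p1, q = (q0 + q1)%N & p = (p0 + p1)%N].
Proof.
elim: {q p}(q + p)%N {-2}q {-2}p (leqnn (q + p)) => [|n IH] q p qpn cqp q0 p0; first lia.
case: (ltngtP q p) => [lt|lt|E].
- have cqp' : coprime q (p - q) by rewrite /coprime -(@gcdnDr q (p - q)) subnK // ltnW.
  case: (IH q (p - q)%N) => //; [lia|lia|] => a [b [c [d [sb e1 e2]]]].
  exists a, (b + a)%N, c, (d + c)%N; split=> //; [exact: stern_brocot_addr|lia].
- have cqp' : coprime (q - p) p.
    by rewrite coprime_sym /coprime -(@gcdnDr p (q - p)) subnK 1?gcdnC // ltnW.
  case: (IH (q - p)%N p) => //; [lia|lia|] => a [b [c [d [sb e1 e2]]]].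
  exists (a + b)%N, b, (c + d)%N, d; split=> //; [exact: stern_brocot_addl|lia].
- move: cqp; rewrite E /coprime gcdnn => /eqP ->.
  by exists 0%N, 1%N, 1%N, 0%N; split=> //; exact: SB_root.
Qed.

(** * The Markoff recurrence and products of word matrices *)

Definition kappa (F : fieldType) (X Y Z : F) := (X ^+ 2 + Y ^+ 2 + Z ^+ 2) / (X * Y * Z).

(** The family on one side of a Farey edge, in coordinates where the edge joins 0 and infinity. The
    vertex across it, with value Z, enters only through the value at 1/1. The last clause reflects
    across the two edges from q/p and q'/p' to their mediant. *)
Definition markoff_sector (F : fieldType) (X Y Z : F) (phi : nat -> nat -> F) : Prop :=
  [/\ phi 0%N 1%N = X, phi 1%N 0%N = Y, phi 1%N 1%N = X * Y * kappa X Y Z - Z &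
    forall q p q' p' : nat, (p * q' = q * p' + 1)%N ->
      phi (q + (q + q'))%N (p + (p + p'))%N
        = phi q p * phi (q + q')%N (p + p')%N * kappa X Y Z - phi q' p' /\
      phi (q + q' + q')%N (p + p' + p')%N
        = phi (q + q')%N (p + p')%N * phi q' p' * kappa X Y Z - phi q p].

Definition corner (F : fieldType) (X Y Z : F) (M : 'M[F]_2) := Y * Z / X * M 0 1.

(** The trace condition is carried along because it turns the coefficient [\tr M] of Cayley-Hamilton
    into [kappa] times a value of the family. *)
Definition represents (F : fieldType) (X Y Z : F) (t : F) (M : 'M[F]_2) :=
  t = corner X Y Z M /\ \tr M = kappa X Y Z * corner X Y Z M.

(** By Cayley-Hamilton A^2 B = tr(A) AB - B, and both the corner and the trace are linear. *)
Lemma represents_mull (F : fieldType) (X Y Z s t u : F) (A B : 'M[F]_2) :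
  \det A = 1 -> represents X Y Z s A -> represents X Y Z t B ->
  represents X Y Z u (A *m B) ->
  represents X Y Z (s * u * kappa X Y Z - t) (A *m (A *m B)).
Proof.
rewrite /represents => dA [-> tA] [-> tB] [-> tAB].
rewrite mulmxA sqrmx_SL2 // mulmxBl mul1mx -scalemxAl.
have E : corner X Y Z (\tr A *: (A *m B) - B)
       = \tr A * corner X Y Z (A *m B) - corner X Y Z B.
  by rewrite /corner !mxE; ring.
by rewrite E linearB linearZ /= tA tB tAB; split; ring.
Qed.

Lemma represents_mulr (F : fieldType) (X Y Z s t u : F) (A B : 'M[F]_2) :
  \det B = 1 -> represents X Y Z s A -> represents X Y Z t B ->
  represents X Y Z u (A *m B) ->
  represents X Y Z (u * t * kappa X Y Z - s) (A *m B *m B).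
Proof.
rewrite /represents => dB [-> tA] [-> tB] [-> tAB].
rewrite -mulmxA sqrmx_SL2 // mulmxBr mulmx1 -scalemxAr.
have E : corner X Y Z (\tr B *: (A *m B) - A)
       = \tr B * corner X Y Z (A *m B) - corner X Y Z A.
  by rewrite /corner !mxE; ring.
by rewrite E linearB linearZ /= tA tB tAB; split; ring.
Qed.

(** Along the tree, the matrix of a mediant is the product of those of its parents. The final
    [false] of the second word is kept explicit: removing it later leaves fewer than q letters
    [false], as the support computation demands. *)
Lemma markoff_words (F : fieldType) (X Y Z : F) phi q p q' p' :
  X != 0 -> Y != 0 -> Z != 0 -> markoff_sector X Y Z phi ->
  stern_brocot q p q' p' ->
  exists w u, let w' := rcons u false in
    [/\ christoffel q p w, christoffel q' p' w',
        represents X Y Z (phi q p) (word_mx X Y Z w),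
        represents X Y Z (phi q' p') (word_mx X Y Z w') &
        represents X Y Z (phi (q + q')%N (p + p')%N) (word_mx X Y Z w *m word_mx X Y Z w')].
Proof.
move=> X0 Y0 Z0 [phi01 phi10 phi11 rec].
elim=> [|{}q {}p {}q' {}p' sb [w [u /= [cw cw' rw rw' rww']]]
        |{}q {}p {}q' {}p' sb [w [u /= [cw cw' rw rw' rww']]]].
- exists [:: true], [::]; rewrite /= phi01 phi10 phi11 /word_mx !big_seq1 /represents /corner.
  rewrite !mxtrace2 !mulmx2E !mxE /= /kappa.
  split; try by (split; field; rewrite ?X0 ?Y0 ?Z0).
  + by split=> // -[|? [|? ?]] l v //= [<- _].
  + by split=> // -[|? [|? ?]] l v //= [<- _].
- have det := stern_brocot_det sb; have [recl _] := rec _ _ _ _ det.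
  exists w, (w ++ u); rewrite /= rcons_cat.
  split=> //; rewrite ?word_mx_cat //; first exact: christoffel_cat.
  by rewrite recl; apply: represents_mull => //; exact: det_word_mx.
- have det := stern_brocot_det sb; have [_ recr] := rec _ _ _ _ det.
  exists (w ++ rcons u false), u; rewrite /=.
  split=> //; rewrite ?word_mx_cat //; first exact: christoffel_cat.
  by rewrite recr; apply: represents_mulr => //; exact: det_word_mx.
Qed.

Lemma markoff_expansion (F : fieldType) (X Y Z : F) phi q p :
  X != 0 -> Y != 0 -> Z != 0 -> markoff_sector X Y Z phi -> coprime q p ->
  exists2 L : seq (nat * nat),
    phi q p = \sum_(e <- L) X ^ (e.1%:Z *+ 2 + 1 - q%:Z) * Y ^ (e.2%:Z *+ 2 + 1 - p%:Z)
                * Z ^ (q%:Z + p%:Z - 1 - e.1%:Z *+ 2 - e.2%:Z *+ 2) &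
    forall a b, ((a, b) \in L) = (a + b < q + p)%N && (q * p <= p * a + q * b)%N.
Proof.
move=> X0 Y0 Z0 sec; have [phi01 phi10 _ _] := sec.
case: (posnP q) => [-> |q0].
  rewrite /coprime gcd0n => /eqP ->; exists [:: (0, 0)%N].
    by rewrite big_seq1 phi01 /= !expr0z !mulr1.
  by move=> [|a] [|b]; rewrite mem_seq1 xpair_eqE /= ?muln0; lia.
case: (posnP p) => [-> |p0].
  rewrite /coprime gcdn0 => /eqP ->; exists [:: (0, 0)%N].
    by rewrite big_seq1 phi10 /= !expr0z mul1r mulr1.
  by move=> [|a] [|b]; rewrite mem_seq1 xpair_eqE /= ?muln0; lia.
move=> cqp; have [a [b [c [d [sb eq ep]]]]] := stern_brocot_coprime cqp q0 p0.
have [w [u /= [cw cw' _ _ []]]] := markoff_words X0 Y0 Z0 sec sb.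
rewrite -eq -ep -word_mx_cat => phiE _.
have := christoffel_cat (stern_brocot_det sb) cw cw'; rewrite -eq -ep.
move: phiE; rewrite -rcons_cat; move: (w ++ u) => v phiE [].
rewrite -cats1 !count_cat /= addn0 addn1 => cq cp /obeys_catl ob.
have v0 : (0 < size v)%N by case: (v) cp => //= cp; move: p0; rewrite -cp.
have cvq : (count negb v < q)%N by rewrite -cq.
have [m1 m2 _ _ _] := mem_row_support cqp p0 cvq v0 ob.
have [s1 s2] := row_word_mx v X0 Y0 Z0.
(* Both entries in the second column of B are X/Z, so the corner of the full word is Y times the sum
   of the first row of [v]. *)
exists ((row_support v).1 ++ (row_support v).2).
  rewrite phiE /corner -cats1 word_mx_cat mulmx2E s1 s2 [word_mx _ _ _ [:: _]]big_seq1 !mxE /=.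
  rewrite -mulrDl -big_cat /=; set S := \sum_(e <- _) _.
  have -> : Y * Z / X * (S * (X / Z)) = S * Y by field; rewrite X0 Z0.
  rewrite mulr_suml; apply: eq_bigr => e _; rewrite /monom.
  have -> : e.1%:Z *+ 2 + 1 - q%:Z = e.1%:Z *+ 2 - (count negb v)%:Z by lia.
  have -> : e.2%:Z *+ 2 + 1 - p%:Z = e.2%:Z *+ 2 - (count id v)%:Z + 1 by lia.
  have -> : q%:Z + p%:Z - 1 - e.1%:Z *+ 2 - e.2%:Z *+ 2
    = (count negb v)%:Z + (count id v)%:Z - e.1%:Z *+ 2 - e.2%:Z *+ 2 by lia.
  by rewrite [Y ^ (_ + 1)]expfzDr // expr1z; ring.
(* For [v], j + 1 = q and k = p, so both lower bounds read q p <= p a + q b, which already excludes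
   the origin. *)
move=> a' b'; rewrite mem_cat m1 m2 -cq -cp; nia.
Qed.

(** * Newton polygons of Laurent polynomials *)

Lemma polyC_mulXn_inj (R : idomainType) (a b : R) (m n : nat) :
  a != 0 -> a%:P * 'X^m = b%:P * 'X^n -> a = b /\ m = n.
Proof.
move=> a0 E.
have ab : a = b.
  by have := congr1 lead_coef E; rewrite !lead_coef_Mmonic ?monicXn // !lead_coefC.
split=> //; have := congr1 (fun r : {poly R} => size r) E.
by rewrite -ab !size_Cmul // !size_polyXn => -[].
Qed.

Lemma Xv_neq0 : Xv != 0.
Proof. by rewrite tofrac_eq0 !polyC_eq0 polyX_eq0. Qed.
Lemma Yv_neq0 : Yv != 0.
Proof. by rewrite tofrac_eq0 polyC_eq0 polyX_eq0. Qed.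
Lemma Zv_neq0 : Zv != 0.
Proof. by rewrite tofrac_eq0 polyX_eq0. Qed.

Lemma mono_nat_inj (a b c a' b' c' : nat) :
  Xv ^+ a * Yv ^+ b * Zv ^+ c = Xv ^+ a' * Yv ^+ b' * Zv ^+ c' ->
  [/\ a = a', b = b' & c = c'].
Proof.
rewrite /Xv /Yv /Zv -!rmorphXn -!rmorphM => /eqP; rewrite tofrac_eq => /eqP.
move=> /polyC_mulXn_inj [].
  by apply: mulf_neq0; rewrite ?polyC_eq0; apply: expf_neq0; rewrite polyX_eq0.
move=> + ->; move=> /polyC_mulXn_inj [].
  by rewrite expf_neq0 ?polyX_eq0.
by move=> /(congr1 (fun r : {poly int} => size r)); rewrite !size_polyXn => -[->] ->.
Qed.

Lemma exprz_nonneg_shift (F : fieldType) (X Y Z : F) (u v w : int) (n : nat) :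
  X != 0 -> Y != 0 -> Z != 0 -> 0 <= u + n%:Z -> 0 <= v + n%:Z -> 0 <= w + n%:Z ->
  X ^ u * Y ^ v * Z ^ w * (X ^ n * Y ^ n * Z ^ n)
  = X ^+ absz (u + n%:Z) * Y ^+ absz (v + n%:Z) * Z ^+ absz (w + n%:Z).
Proof.
move=> X0 Y0 Z0 u0 v0 w0.
have pw (x : F) (m : int) : 0 <= m -> x ^+ absz m = x ^ m by case: m.
by rewrite !pw // !expfzDr //; ring.
Qed.

(** Multiplying by a high power of XYZ reduces to natural exponents, read off in the iterated
    polynomial ring. *)
Lemma mono_inj : injective mono.
Proof.
move=> [[a b] c] [[a' b'] c']; rewrite /mono /= => E.
have [n [ha hb hc] [ha' hb' hc']] : exists2 n : nat, [/\ 0 <= a + n%:Z, 0 <= b + n%:Z & 0 <= c + n%:Z]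
    & [/\ 0 <= a' + n%:Z, 0 <= b' + n%:Z & 0 <= c' + n%:Z].
  clear E; exists (`|a| + `|b| + `|c| + `|a'| + `|b'| + `|c'|)%N; split; lia.
have := congr1 (fun t => t * (Xv ^ n * Yv ^ n * Zv ^ n)) E; cbn beta; clear E.
rewrite (exprz_nonneg_shift Xv_neq0 Yv_neq0 Zv_neq0 ha hb hc).
rewrite (exprz_nonneg_shift Xv_neq0 Yv_neq0 Zv_neq0 ha' hb' hc').
move=> /mono_nat_inj [/(congr1 Posz) ea /(congr1 Posz) eb /(congr1 Posz) ec].
move: ea eb ec; rewrite !gez0_abs // => /addIr -> /addIr -> /addIr ->.
by [].
Qed.

(* [t.1] is a normal vector and [t.2] a lower bound. *)
Definition halfspace (t : exps * int) (nu : exps) : bool :=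
  t.2 <= t.1.1.1 * nu.1.1 + t.1.1.2 * nu.1.2 + t.1.2 * nu.2.

(** A convex combination preserves each linear inequality, so the hull never has to be computed. *)
Lemma in_hull_halfspace (R : realType) (S : seq exps) (nu : exps) t :
  (forall mu, mu \in S -> halfspace t mu) -> in_hull R S nu -> halfspace t nu.
Proof.
move=> tS [lam [lam0 [lam1 [l1 [l2 l3]]]]].
rewrite /halfspace -(ler_int R) !intrD !intrM -l1 -l2 -l3.
rewrite -[leLHS]mul1r -[X in X * _ <= _]lam1 mulr_suml !mulr_sumr -!big_split /=.
rewrite big_seq [leRHS]big_seq; apply: ler_sum => mu /tS.
rewrite /halfspace -(ler_int R) !intrD !intrM => H.
apply: le_trans (ler_wpM2l (lam0 mu) H) _.
by rewrite le_eqVlt; apply/orP; left; apply/eqP; ring.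
Qed.

Definition cut_out (E : seq exps) (H : seq (exps * int)) (v : exps) : Prop :=
  forall nu, (nu \in E) <-> (all (fun t => halfspace t nu) H /\ same_parity nu v).

Lemma same_parity_sym u v : same_parity u v -> same_parity v u.
Proof. by case=> h1 h2 h3; split; rewrite -opprB rpredN. Qed.

Lemma same_parity_trans u v w : same_parity u v -> same_parity v w -> same_parity u w.
Proof.
have D (a b c : int) : (a - b \in dvdz 2)%Z -> (b - c \in dvdz 2)%Z -> (a - c \in dvdz 2)%Z.
  by move=> h1 h2; rewrite -[a](subrK b) -addrA rpredD.
by case=> h1 h2 h3 [g1 g2 g3]; split; [exact: D h1 g1|exact: D h2 g2|exact: D h3 g3].
Qed.

(** Coefficients are multiplicities in [E], hence positive on the support. A hull point satisfies
    every inequality of [H], so with the right parity it lies in [E]; [mono_inj] forces the exponent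
    of g to be [e0]. *)
Lemma saturated_laurent (R : realType) (t g : RatFun) (E : seq exps) H v e0 :
  t = \sum_(e <- E) mono e -> cut_out E H v -> g = mono e0 -> same_parity v e0 ->
  exists (c : exps -> int) (S : seq exps),
      [/\ uniq S,
          (forall nu, (c nu != 0) = (nu \in S)),
          t = laurent c S,
          (forall nu, nu \in S -> 0 < c nu)
        & forall e : exps, g = mono e ->
            forall nu : exps, in_hull R S nu -> same_parity nu e -> c nu != 0].
Proof.
move=> -> EH -> ve0; exists (fun nu => (count_mem nu E)%:Z), (undup E).
have cE nu : ((count_mem nu E)%:Z != 0) = (nu \in E) by rewrite -has_pred1 has_count lt0n.
split.
- exact: undup_uniq.
- by move=> nu; rewrite mem_undup cE.
- rewrite /laurent -big_undup_iterop_count; apply: eq_bigr => nu _.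
  by rewrite -pmulrn mulr_natl.
- by move=> nu; rewrite mem_undup -has_pred1 has_count ltz_nat.
move=> e /mono_inj <- nu hull par; rewrite cE EH; split.
  apply/allP => h hH; apply: in_hull_halfspace hull => mu; rewrite mem_undup EH => -[/allP al _].
  exact: al.
exact: same_parity_trans par (same_parity_sym ve0).
Qed.

Definition rot3 (e : exps) : exps := (e.2, e.1.1, e.1.2).

Lemma cut_out_rot E H v : cut_out E H v ->
  cut_out (map rot3 E) (map (fun t => (rot3 t.1, t.2)) H) (rot3 v).
Proof.
move=> EH [[a b] c].
have inj : injective rot3 by move=> [[? ?] ?] [[? ?] ?] [-> -> ->].
rewrite -[(a, b, c)]/(rot3 (b, c, a)) (mem_map inj) EH all_map.
have -> : all (preim (fun t => (rot3 t.1, t.2)) (fun t => halfspace t (rot3 (b, c, a)))) H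
        = all (fun t => halfspace t (b, c, a)) H.
  apply: eq_all => t; rewrite /halfspace /=; congr (_ <= _); ring.
by split=> -[h [h1 h2 h3]].
Qed.

(** * The three sectors of the Farey tessellation *)

Lemma pt_opp q p : pt (- q) (- p) = pt q p.
Proof. by rewrite /pt oppr_eq0; case: ifP => // _; rewrite !rmorphN /= invrN mulrNN. Qed.

Lemma pt_cross q p q' p' : pt q p = pt q' p' -> q * p' = q' * p.
Proof.
rewrite /pt; case: eqP => [->|/eqP p0]; case: eqP => [->|/eqP p'0] //; rewrite ?mulr0 //.
have i0 (n : int) : n != 0 -> n%:~R != 0 :> rat by rewrite intr_eq0.
by move=> [] /eqP; rewrite eqr_div ?i0 // -!intrM eqr_int => /eqP ->.
Qed.

Definition farey_recurrence (F : fieldType) (K : F) (f : P1Q -> F) : Prop :=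
  forall s0 s1 s s' : P1Q,
    farey_tri s0 s1 s -> farey_tri s0 s1 s' -> s <> s' ->
    f s + f s' = f s0 * f s1 * K.

(** The two triangles on the edge have third vertices the sum and the difference: negating (q1, p1)
    names the same point. *)
Lemma farey_recurrence_pt (F : fieldType) (K : F) f (q0 p0 q1 p1 : int) :
  farey_recurrence K f -> (q0 * p1 - q1 * p0 = 1 \/ q0 * p1 - q1 * p0 = -1) ->
  f (pt (q0 + q1) (p0 + p1)) + f (pt (q0 - q1) (p0 - p1)) = f (pt q0 p0) * f (pt q1 p1) * K.
Proof.
move=> rec det; apply: rec.
- exists q0, p0, q1, p1; split=> //; rewrite perm_cons; exact: (permEl (perm_catC [:: _] [:: _])).
- exists q0, p0, (- q1), (- p1); split.
    by rewrite mulrN mulNr -opprB opprK; case: det => det; [right|left]; lia.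
  rewrite pt_opp perm_cons; exact: (permEl (perm_catC [:: _] [:: _])).
- move/pt_cross => E.
  (* The cross product of the two third vertices is twice the determinant, hence nonzero. *)
  have : (q0 * p1 - q1 * p0) * 2 = (q0 - q1) * (p0 + p1) - (q0 + q1) * (p0 - p1) by ring.
  rewrite E subrr; lia.
Qed.

(** The matrix with rows (a, b) and (c, d) in SL2(Z) preserves the Farey triangulation and carries
    0, infinity, -1 to the points valued X, Y, Z. *)
Lemma markoff_sector_of (F : fieldType) f (a b c d : int) (X Y Z : F) :
  farey_recurrence (kappa X Y Z) f -> a * d - b * c = 1 ->
  f (pt b d) = X -> f (pt a c) = Y -> f (pt (a - b) (c - d)) = Z ->
  markoff_sector X Y Z
      (fun q p : nat => f (pt (a * q%:Z + b * p%:Z) (c * q%:Z + d * p%:Z))).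
Proof.
rewrite /markoff_sector; move: (kappa X Y Z) => K rec det <- <- <-; split.
- by rewrite !mulr0 !add0r !mulr1.
- by rewrite !mulr0 !addr0 !mulr1.
- rewrite !mulr1 [f (pt b d) * _]mulrC -(farey_recurrence_pt rec) ?addrK //.
  by left; rewrite -det; ring.
move=> q p q' p' qp.
have qpZ : p%:Z * q'%:Z = q%:Z * p'%:Z + 1 by rewrite -!PoszM -[1]/(Posz 1) -PoszD qp.
set u := a * q%:Z + b * p%:Z; set v := c * q%:Z + d * p%:Z.
set u' := a * q'%:Z + b * p'%:Z; set v' := c * q'%:Z + d * p'%:Z.
have det' : u * v' - u' * v = -1.
  have -> : u * v' - u' * v = (a * d - b * c) * (q%:Z * p'%:Z - p%:Z * q'%:Z).
    by rewrite /u /v /u' /v'; ring.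
  by rewrite det qpZ; ring.
have lin e g (x y x' y' : nat) : e * (x + x')%:Z + g * (y + y')%:Z
  = (e * x%:Z + g * y%:Z) + (e * x'%:Z + g * y'%:Z) by rewrite !PoszD; ring.
rewrite !lin -/u -/v -/u' -/v'; split.
- rewrite -(farey_recurrence_pt rec); last by right; rewrite -det'; ring.
  have sub (x y : int) : x - (x + y) = - y by ring.
  by rewrite !sub pt_opp addrK.
- rewrite -(farey_recurrence_pt rec); last by right; rewrite -det'; ring.
  by rewrite !addrK.
Qed.

(** The first two half-spaces fix the total degree to 1; the others translate a >= 0, b >= 0, a + b
    < q + p and q p <= p a + q b. *)
Lemma cut_out_sector (q p : nat) (L : seq (nat * nat)) :
  (forall a b, ((a, b) \in L) = (a + b < q + p)%N && (q * p <= p * a + q * b)%N) ->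
  cut_out [seq (e.1%:Z *+ 2 + 1 - q%:Z, e.2%:Z *+ 2 + 1 - p%:Z,
                q%:Z + p%:Z - 1 - e.1%:Z *+ 2 - e.2%:Z *+ 2) | e <- L]
    [:: (1, 1, 1, 1); (-1, -1, -1, -1); (1, 0, 0, 1 - q%:Z); (0, 1, 0, 1 - p%:Z);
        (0, 0, 1, 1 - q%:Z - p%:Z); (p%:Z, q%:Z, 0, p%:Z + q%:Z)]
    (1 - q%:Z, 1 - p%:Z, 1 - q%:Z - p%:Z).
Proof.
move=> mem [[x y] z]; rewrite /halfspace /same_parity /=; split.
- move=> /mapP [[a b]]; rewrite mem => /andP [/= h1 h2] [-> -> ->]; split.
    rewrite andbT; apply/and5P; split; [lia|lia|lia|lia|apply/andP; split; [lia|]].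
    nia.
  split; apply/dvdzP.
  + by exists a%:Z; lia.
  + by exists b%:Z; lia.
  + by exists (q%:Z + p%:Z - 1 - a%:Z - b%:Z); lia.
- rewrite andbT => -[/and5P [h1 h2 h3 h4 /andP [h5 h6]] [/dvdzP [a ea] /dvdzP [b eb] _]].
  have a0 : 0 <= a by lia.
  have b0 : 0 <= b by lia.
  apply/mapP; exists (absz a, absz b).
    rewrite mem; apply/andP; split; first lia.
    rewrite -lez_nat !PoszD !PoszM !gez0_abs //; nia.
  rewrite /= !gez0_abs //; congr (_, _, _); lia.
Qed.

Definition lowest_terms (s : P1Q) : int * int :=
  if s is Some r then (numq r, denq r) else (1, 0).

Lemma bracket_mono (f : P1Q -> RatFun) s :
  f (Some 0) = Xv -> f oo = Yv -> f (Some (-1)) = Zv ->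
  let u := (lowest_terms s).1 in let v := (lowest_terms s).2 in
  exists2 e0, f (bracket s) = mono e0 & same_parity (1 - u, 1 - v, 1 - u - v) e0.
Proof.
move=> fX fY fZ /=.
have mX : f (Some 0) = mono (1, 0, 0) by rewrite fX /mono /= expr1z !expr0z !mulr1.
have mY : f oo = mono (0, 1, 0) by rewrite fY /mono /= expr1z !expr0z mulr1 mul1r.
have mZ : f (Some (-1)) = mono (0, 0, 1) by rewrite fZ /mono /= expr1z !expr0z !mul1r.
have par (x y z k l m : int) e : x = k * 2 + e.1.1 -> y = l * 2 + e.1.2 -> z = m * 2 + e.2 ->
    same_parity (x, y, z) e.
  by move=> -> -> ->; split; rewrite /= addrK dvdz_mull.
have half (x : int) : exists k : int, x = k * 2 + (nat_of_bool (odd `|x|))%:Z.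
  case: x => n.
    by exists (n./2)%:Z; have := odd_double_half n; rewrite /=; lia.
  exists (- (n.+1./2)%:Z - (nat_of_bool (odd n.+1))%:Z).
  by have := odd_double_half n.+1; rewrite NegzE abszN /=; lia.
case: s => [r|]; last first.
  exists (0, 1, 0); first exact: mY.
  exact: (@par _ _ _ 0 0 0).
rewrite [bracket _]/= [lowest_terms _]/=; set u := numq r; set v := denq r.
have cop : coprime `|u| `|v| by exact: coprime_num_den.
clearbody u v; clear fX fY fZ.
have [[k uk] [l vl]] := (half u, half v).
case: ifP => [ov|/negbFE ov].
  (* Lowest terms exclude two even entries. *)
  have ou : odd `|u|.
    apply: contraT => ou; move: cop; rewrite /coprime => /eqP cop.
    have : (2 %| gcdn `|u| `|v|)%N by rewrite dvdn_gcd !dvdn2 ou ov.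
    by rewrite cop.
  rewrite ou /= in uk; rewrite (negbTE ov) /= in vl; exists (0, 1, 0); first exact: mY.
  by clear mX mY mZ; apply: (@par _ _ _ (- k) (- l) (- k - l)) => /=; lia.
rewrite ov /= in vl; case: ifP => [ou|/negbFE ou].
  rewrite (negbTE ou) /= in uk; exists (1, 0, 0); first exact: mX.
  by clear mX mY mZ; apply: (@par _ _ _ (- k) (- l) (- k - l)) => /=; lia.
rewrite ou /= in uk; exists (0, 0, 1); first exact: mZ.
by clear mX mY mZ; apply: (@par _ _ _ (- k) (- l) (- k - l - 1)) => /=; lia.
Qed.

Lemma kappa_rot (F : fieldType) (X Y Z : F) : kappa Y Z X = kappa X Y Z.
Proof. by rewrite /kappa; congr (_ / _); ring. Qed.

Lemma mulr_rot3 (F : fieldType) (x y z : F) : x * y * z = z * x * y.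
Proof. by rewrite mulrC mulrA. Qed.

Lemma mono_rot e : mono (rot3 e) = Yv ^ e.1.1 * Zv ^ e.1.2 * Xv ^ e.2.
Proof. exact: esym (mulr_rot3 _ _ _). Qed.

Lemma mono_rot2 e : mono (rot3 (rot3 e)) = Zv ^ e.1.1 * Xv ^ e.1.2 * Yv ^ e.2.
Proof. exact: mulr_rot3. Qed.

(** The triangle 0, infinity, -1 cuts the circle into three arcs: s >= 0 or infinity, s <= -1, and
    -1 < s < 0. *)
Lemma rat_sector s :
  let u := (lowest_terms s).1 in let v := (lowest_terms s).2 in
  s = pt u v /\ exists q p : nat, coprime q p /\
    [\/ u = q%:Z /\ v = p%:Z,
        u = - (q + p)%:Z /\ v = q%:Z | u = - p%:Z /\ v = (q + p)%:Z].
Proof.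
case: s => [r|]; last by split=> //; exists 1%N, 0%N; split=> //; constructor 1.
rewrite /=; split.
  by rewrite /pt (negbTE (denq_neq0 r)) divq_num_den.
have := coprime_num_den r; have := denq_gt0 r.
case: (denq r) => // d _; case: (numq r) => [n|n]; rewrite ?NegzE ?abszN /= => cop.
  by exists n, d; split=> //; constructor 1.
case: (leqP d n.+1) => [dn|nd].
  exists d, (n.+1 - d)%N; split; last by constructor 2; split=> //; lia.
  by rewrite /coprime -(@gcdnDr d (n.+1 - d)) subnK // gcdnC.
exists (d - n.+1)%N, n.+1; split; last by constructor 3; split=> //; lia.
by rewrite coprime_sym /coprime -(@gcdnDr n.+1 (d - n.+1)) subnK // ltnW.
Qed.

Lemma same_parity_sector2 (q p : int) :
  same_parity (rot3 (1 - q, 1 - p, 1 - q - p)) (1 + (q + p), 1 - q, 1 + (q + p) - q).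
Proof.
by split; apply/dvdzP; [exists (- (q + p))|exists 0|exists (- p)]; rewrite /=; ring.
Qed.

Lemma same_parity_sector3 (q p : int) :
  same_parity (rot3 (rot3 (1 - q, 1 - p, 1 - q - p))) (1 + p, 1 - (q + p), 1 + p - (q + p)).
Proof.
by split; apply/dvdzP; [exists (- p)|exists 0|exists 0]; rewrite /=; ring.
Qed.

(** Common to the three arcs; [r] permutes exponents cyclically, as X, Y, Z are permuted. *)
Lemma sector_conclusion (R : realType) (X Y Z : RatFun) (phi : nat -> nat -> RatFun)
    (q p : nat) (g : RatFun) (r : exps -> exps) e0 :
  X != 0 -> Y != 0 -> Z != 0 -> markoff_sector X Y Z phi -> coprime q p ->
  (forall e, mono (r e) = X ^ e.1.1 * Y ^ e.1.2 * Z ^ e.2) ->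
  (forall E H v, cut_out E H v -> exists H', cut_out (map r E) H' (r v)) ->
  g = mono e0 -> same_parity (r (1 - q%:Z, 1 - p%:Z, 1 - q%:Z - p%:Z)) e0 ->
  exists (c : exps -> int) (S : seq exps),
      [/\ uniq S,
          (forall nu, (c nu != 0) = (nu \in S)),
          phi q p = laurent c S,
          (forall nu, nu \in S -> 0 < c nu)
        & forall e : exps, g = mono e ->
            forall nu : exps, in_hull R S nu -> same_parity nu e -> c nu != 0].
Proof.
move=> X0 Y0 Z0 sec cop rE rcut ge par.
have [L phiE mem] := markoff_expansion X0 Y0 Z0 sec cop.
have [H cut] := rcut _ _ _ (cut_out_sector mem).
apply: saturated_laurent cut ge par.
by rewrite phiE !big_map; apply: eq_bigr => e _; rewrite rE.
Qed.

Theorem theorem1 (R : realType) (f : P1Q -> RatFun) :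
  f (Some 0) = Xv -> f oo = Yv -> f (Some (-1)) = Zv ->
  (forall s0 s1 s s' : P1Q,
      farey_tri s0 s1 s -> farey_tri s0 s1 s' -> s <> s' ->
      f s + f s' = f s0 * f s1 * ((Xv ^+ 2 + Yv ^+ 2 + Zv ^+ 2) / (Xv * Yv * Zv))) ->
  forall s : P1Q,
    exists (c : exps -> int) (S : seq exps),
      [/\ uniq S,
          (forall nu, (c nu != 0) = (nu \in S)),
          f s = laurent c S,
          (forall nu, nu \in S -> 0 < c nu)
        & forall e : exps, f (bracket s) = mono e ->
            forall nu : exps, in_hull R S nu -> same_parity nu e -> c nu != 0].
Proof.
move=> fX fY fZ rec s.
have recK : farey_recurrence (kappa Xv Yv Zv) f by [].
have recK1 : farey_recurrence (kappa Yv Zv Xv) f by rewrite kappa_rot.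
have recK2 : farey_recurrence (kappa Zv Xv Yv) f by rewrite 2!kappa_rot.
have p0 : pt 0 1 = Some 0 by rewrite /pt /= mul0r.
have p1 : pt (- 1) 1 = Some (- 1) by rewrite /pt /= divr1.
have p1' : pt 1 (- 1) = Some (- 1) by rewrite -p1 -[LHS]pt_opp opprK.
have poo q : pt q 0 = oo by [].
have [e0 be par] := bracket_mono s fX fY fZ.
have [] := rat_sector s; move: par; case: (lowest_terms s) => u v /= par sE.
case=> q [p [cop []]] [uE vE].
- have sec : markoff_sector Xv Yv Zv
      (fun q p : nat => f (pt (1 * q%:Z + 0 * p%:Z) (0 * q%:Z + 1 * p%:Z))).
    by apply: markoff_sector_of => //; rewrite ?p0 ?poo ?sub0r ?subr0 ?p1'.
  have -> : f s =
      (fun q p : nat => f (pt (1 * q%:Z + 0 * p%:Z) (0 * q%:Z + 1 * p%:Z))) q p.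
    by rewrite sE uE vE !mul1r !mul0r addr0 add0r.
  apply: (sector_conclusion R Xv_neq0 Yv_neq0 Zv_neq0 sec cop (r := id)) be _ => //.
    by move=> E H w cut; exists H; rewrite map_id.
  by rewrite -uE -vE.
(* The matrix with rows (-1, -1) and (1, 0) rotates the base triangle: 0 -> infinity -> -1 -> 0. *)
- have sec : markoff_sector Yv Zv Xv
      (fun q p : nat => f (pt (-1 * q%:Z + -1 * p%:Z) (1 * q%:Z + 0 * p%:Z))).
    by apply: markoff_sector_of => //; rewrite ?p1 ?poo ?subrr ?subr0 ?p0.
  have -> : f s =
      (fun q p : nat => f (pt (-1 * q%:Z + -1 * p%:Z) (1 * q%:Z + 0 * p%:Z))) q p.
    by rewrite sE uE vE !mulN1r mul1r mul0r addr0 PoszD opprD.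
  apply: (sector_conclusion R Yv_neq0 Zv_neq0 Xv_neq0 sec cop mono_rot) be _ => //.
    by move=> E H w cut; eexists; apply: cut_out_rot cut.
  apply: same_parity_trans par.
  by rewrite uE vE opprK PoszD; exact: same_parity_sector2.
(* The inverse rotation: 0 -> -1 -> infinity -> 0. *)
- have sec : markoff_sector Zv Xv Yv
      (fun q p : nat => f (pt (0 * q%:Z + -1 * p%:Z) (1 * q%:Z + 1 * p%:Z))).
    by apply: markoff_sector_of => //; rewrite ?p1 ?subrr ?sub0r ?opprK ?p0.
  have -> : f s =
      (fun q p : nat => f (pt (0 * q%:Z + -1 * p%:Z) (1 * q%:Z + 1 * p%:Z))) q p.
    by rewrite sE uE vE mulN1r !mul1r mul0r add0r PoszD.
  apply: (sector_conclusion R Zv_neq0 Xv_neq0 Yv_neq0 sec cop mono_rot2) be _ => //.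
    move=> E H w cut; eexists; rewrite (map_comp rot3 rot3); apply: cut_out_rot; apply: cut_out_rot cut.
  apply: same_parity_trans par.
  by rewrite uE vE opprK PoszD; exact: same_parity_sector3.
Qed.
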